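(* Let $M,K\ge 2$ and $Q\ge 1$ be integers and let $i\in\{1,2,3,4,5\}$. Let $P'$ be a probability distribution on $[M]^K$ and, for each $z\in[Q]$, let $P(\cdot,\cdot\mid Z=z)$ be a probability distribution on $[K]\times[M]$. Then the following are equivalent: (a) there exists a joint distribution of $(Z,X,Y(x_1),\dots,Y(x_K))$ belonging to model $\mathcal{M}_i$ (with $P(Z=z)>0$ for all $z\in[Q]$) whose marginal distribution of $(Y(x_1),\dots,Y(x_K))$ is $P'$ and whose conditional distribution of $(X,Y)$ given $Z=z$ is $P(\cdot,\cdot\mid Z=z)$ for every $z\in[Q]$; (b) for every $z\in[Q]$ and every tuple $(\mathcal{V}^{(1)},\dots,\mathcal{V}^{(K)})$ of non-empty subsets of $[M]$ such that $\mathcal{V}^{(k)}\neq[M]$ for at least one $k$, $$P'\big(Y(x_1)\in\mathcal{V}^{(1)},\dots,Y(x_K)\in\mathcal{V}^{(K)}\big)\le \sum_{k=1}^K P\big(X=k,\,Y\in\mathcal{V}^{(k)}\mid Z=z\big).$$ In particular, the set of pairs characterized is the same for all five models. The number of inequalities in (b) is $Q\big((2^M-1)^K-1\big)$.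
   Context: Notation: $[n]=\{1,\dots,n\}$. Outcome $Y\in[M]$, treatment $X\in[K]$, instrument $Z\in[Q]$. There are potential outcomes $Y(x_i,z_q)$ ($i\in[K]$, $q\in[Q]$), the value $Y$ would take if $X$ were set to $i$ and $Z$ to $q$, and (where used) potential treatments $X(z_q)$. Consistency: $Y=Y(X,Z)$, and $X=X(Z)$ whenever $X(z)$ potential outcomes are present. Define $Y(x_i):=Y(x_i,Z)$. $U$ denotes a latent variable with arbitrary state space. Exclusion assumptions: (E1) individual-level: $Y(x_i,z)=Y(x_i,\tilde z)$ a.s. for all $z,\tilde z\in[Q]$, $i\in[K]$. (E2) joint stochastic: $(Y(x_1,z),\dots,Y(x_K,z))$ and $(Y(x_1,\tilde z),\dots,Y(x_K,\tilde z))$ have the same distribution for all $z,\tilde z$. (E3) latent stochastic: the conditional distribution of $Y(x,z)$ given $U$ equals that of $Y(x,\tilde z)$ given $U$ for all $z,\tilde z,x$. Independence assumptions: (I1) random assignment: $Z\perp\!\!\!\perp\{Y(x,z),X(z):x\in[K],z\in[Q]\}$. (I2) joint independence: $Z\perp\!\!\!\perp\{Y(x,z):x\in[K],z\in[Q]\}$. (I3) single-world: for all $z,x$, $Z\perp\!\!\!\perp (X(z),Y(x,z))$. (I4) latent-variable: there is $U$ with $U\perp\!\!\!\perp Z$ and, for all $z,x$, $Y(x,z)\perp\!\!\!\perp (X,Z)\mid U$. Models: $\mathcal{M}_1$ = (E1)+(I1); $\mathcal{M}_2$ = (E1)+(I2); $\mathcal{M}_3$ = (E2)+(I2); $\mathcal{M}_4$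 = (E1)+(I3); $\mathcal{M}_5$ = (E3)+(I4) (same $U$ in both). *)

(* Defs.v *)
From HB Require Import structures.
From mathcomp Require Import all_boot all_order all_algebra.
From mathcomp Require Import all_classical all_reals all_analysis.

Set Implicit Arguments.
Unset Strict Implicit.
Unset Printing Implicit Defensive.
Import Order.TTheory GRing.Theory Num.Theory.

Local Open Scope classical_set_scope.
Local Open Scope ring_scope.

(* Index conventions: [n] = {1,..,n} is represented by 'I_n = {0,..,n-1}.
   Outcome Y in 'I_M, treatment X in 'I_K, instrument Z in 'I_Q. *)

Inductive IVmodel := Mod1 | Mod2 | Mod3 | Mod4 | Mod5.

Section IVModels.
Context (R : realType) (M K Q : nat).
Context (d : measure_display) (Om : measurableType d) (P : probability Om R).

Definition fin_rv (A : finType) (f : Om -> A) : Prop :=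
  forall a : A, measurable (f @^-1` [set a]).

(* Random elements on the probability space:
   Z : instrument, X : treatment,
   Ypo i z : potential outcome Y(x_i, z),
   Xpo z   : potential treatment X(z) (only used by the models that have it). *)
Variables (Z : Om -> 'I_Q) (X : Om -> 'I_K)
          (Ypo : 'I_K -> 'I_Q -> Om -> 'I_M) (Xpo : 'I_Q -> Om -> 'I_K).

(* Consistency Y = Y(X, Z): the observed outcome. *)
Definition Yobs (w : Om) : 'I_M := Ypo (X w) (Z w) w.

Definition Yx (i : 'I_K) (w : Om) : 'I_M := Ypo i (Z w) w.

Definition excl_E1 : Prop :=
  forall (i : 'I_K) (z z' : 'I_Q), P [set w | Ypo i z w <> Ypo i z' w] = 0%E.

Definition excl_E2 : Prop :=
  forall (z z' : 'I_Q) (a : {ffun 'I_K -> 'I_M}),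
    P [set w | forall i, Ypo i z w = a i] = P [set w | forall i, Ypo i z' w = a i].

Definition indep_I1 : Prop :=
  forall (q : 'I_Q) (a : {ffun 'I_K * 'I_Q -> 'I_M}) (b : {ffun 'I_Q -> 'I_K}),
    P [set w | Z w = q /\ (forall i z, Ypo i z w = a (i, z)) /\ (forall z, Xpo z w = b z)]
    = (P [set w | Z w = q] *
       P [set w | (forall i z, Ypo i z w = a (i, z)) /\ (forall z, Xpo z w = b z)])%E.

Definition indep_I2 : Prop :=
  forall (q : 'I_Q) (a : {ffun 'I_K * 'I_Q -> 'I_M}),
    P [set w | Z w = q /\ (forall i z, Ypo i z w = a (i, z))]
    = (P [set w | Z w = q] * P [set w | forall i z, Ypo i z w = a (i, z)])%E.

Definition indep_I3 : Prop :=
  forall (z : 'I_Q) (i : 'I_K) (q : 'I_Q) (k : 'I_K) (m : 'I_M),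
    P [set w | Z w = q /\ Xpo z w = k /\ Ypo i z w = m]
    = (P [set w | Z w = q] * P [set w | Xpo z w = k /\ Ypo i z w = m])%E.

Section Latent.
Context (dT : measure_display) (T : measurableType dT) (U : Om -> T).

Definition cprob_version (E : set Om) (f : T -> R) : Prop :=
  measurable_fun setT f /\ (forall t, 0 <= f t <= 1) /\
  forall A : set T, measurable A ->
    P (E `&` U @^-1` A) = (\int[P]_(w in U @^-1` A) (f (U w))%:E)%E.

Definition cond_indep (A B : finType) (V : Om -> A) (W : Om -> B) : Prop :=
  forall (a : A) (b : B), exists f g : T -> R,
    [/\ cprob_version [set w | V w = a] f,
        cprob_version [set w | W w = b] g &
        cprob_version [set w | V w = a /\ W w = b] (fun t => f t * g t)].

Definition excl_E3 : Prop :=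
  forall (i : 'I_K) (z z' : 'I_Q) (m : 'I_M), exists f : T -> R,
    cprob_version [set w | Ypo i z w = m] f /\
    cprob_version [set w | Ypo i z' w = m] f.

Definition indep_I4 : Prop :=
  (forall (A : set T) (q : 'I_Q), measurable A ->
     P (U @^-1` A `&` [set w | Z w = q]) = (P (U @^-1` A) * P [set w | Z w = q])%E) /\
  (forall (i : 'I_K) (z : 'I_Q), cond_indep (Ypo i z) (fun w => (X w, Z w))).

End Latent.

Definition consistency_X : Prop := forall w, X w = Xpo (Z w) w.

Definition model_holds (mdl : IVmodel) : Prop :=
  match mdl with
  | Mod1 => consistency_X /\ excl_E1 /\ indep_I1
  | Mod2 => excl_E1 /\ indep_I2
  | Mod3 => excl_E2 /\ indep_I2
  | Mod4 => consistency_X /\ excl_E1 /\ indep_I3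
  | Mod5 => exists (dT : measure_display) (T : measurableType dT) (U : Om -> T),
              [/\ measurable_fun setT U, excl_E3 U & indep_I4 U]
  end.

End IVModels.

Definition compatible (R : realType) (M K Q : nat) (mdl : IVmodel)
    (Pm : {ffun 'I_K -> 'I_M} -> R) (Pc : 'I_Q -> 'I_K -> 'I_M -> R) : Prop :=
  exists (d : measure_display) (Om : measurableType d) (P : probability Om R)
         (Z : Om -> 'I_Q) (X : Om -> 'I_K)
         (Ypo : 'I_K -> 'I_Q -> Om -> 'I_M) (Xpo : 'I_Q -> Om -> 'I_K),
    [/\ fin_rv Z, fin_rv X, (forall i z, fin_rv (Ypo i z)) & (forall z, fin_rv (Xpo z))] /\
    model_holds P Z X Ypo Xpo mdl /\
    (forall q : 'I_Q, (0 < P [set w | Z w = q])%E) /\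
    (forall a : {ffun 'I_K -> 'I_M},
        P [set w | forall i, Yx Z Ypo i w = a i] = (Pm a)%:E) /\
    (forall (q : 'I_Q) (k : 'I_K) (m : 'I_M),
        P [set w | Z w = q /\ X w = k /\ Yobs Z X Ypo w = m]
        = ((Pc q k m)%:E * P [set w | Z w = q])%E).

Definition ineqs_hold (R : realType) (M K Q : nat)
    (Pm : {ffun 'I_K -> 'I_M} -> R) (Pc : 'I_Q -> 'I_K -> 'I_M -> R) : Prop :=
  forall (q : 'I_Q) (V : 'I_K -> {set 'I_M}),
    (forall k, V k != finset.set0) -> (exists k, V k != [set: 'I_M]%SET) ->
    \sum_(a : {ffun 'I_K -> 'I_M} | [forall k, a k \in V k]) Pm a
      <= \sum_(k < K) \sum_(m in V k) Pc q k m.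

(* Main.v *)
(** For a fixed value [z] of the instrument, condition (b) is Hall's condition
    for transporting [P'] to [P(., . | Z = z)] along the pairs [(a, (k, m))] with
    [a k = m]: a vector [a] has all its neighbours in [{(k, m) | m \in V k}]
    exactly when it lies in the box [V 1 * ... * V K].  Hall's theorem therefore
    yields, for each [z], a conditional law of [X] given [(Y(x_1), ..., Y(x_K))],
    and drawing the [X(z)] conditionally independently, with an independent
    uniform [Z], realises all five models at once (with the vector of potential
    outcomes as latent variable [U]).

    Conversely each model gives
    [P(Y(x_i) \in V i for all i) <= P(Y \in V X | Z = z)], since on the event on
    the left the observed outcome lies in [V X].  For [M_5], where only
    single outcomes are conditionally independent of [(X, Z)] given [U], both
    sides are compared through [E[min_k P(Y(x_k) \in V k | U)]]. *)
Require Import Defs.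
From HB Require Import structures.
From mathcomp Require Import all_boot all_order all_algebra.
From mathcomp Require Import all_classical all_reals all_analysis.
From mathcomp Require Import measurable_realfun ring lra.
Import Order.TTheory GRing.Theory Num.Theory.
Import numFieldNormedType.Exports.
Local Open Scope ring_scope.

Set Implicit Arguments.
Unset Strict Implicit.
Unset Printing Implicit Defensive.

(** * Hall's theorem with real weights, by compactness *)

Lemma sum_continuous (R : realType) (T : topologicalType) (I : finType)
    (g : I -> T -> R) :
  (forall i, continuous (g i)) -> continuous (fun x => \sum_i g i x).
Proof.
move=> g_cont; elim: (index_enum I) => [|i r IH] x.
  rewrite (_ : (fun _ => _) = cst 0); first exact: cvg_cst.
  by apply/funext => y; rewrite big_nil.
rewrite (_ : (fun _ => _) = (g i \+ fun y => \sum_(j <- r) g j y)).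
  by apply: cvgD; [exact: g_cont | exact: IH].
by apply/funext => y; rewrite big_cons.
Qed.

Lemma sqr_sub_continuous (R : realType) (T : topologicalType) (g : T -> R) (r : R) :
  continuous g -> continuous (fun x => (g x - r) ^+ 2).
Proof.
move=> g_cont x.
apply: (@cvg_comp _ _ _ (fun x => g x - r) (fun y : R => y ^+ 2)).
  by apply: cvgB; [exact: g_cont | exact: cvg_cst].
exact: exprn_continuous.
Qed.

Section WeightedHall.
Local Open Scope classical_set_scope.
Context (R : realType) (A B : finType) (e : A -> B -> bool).
Context (p : A -> R) (c : B -> R).
Hypothesis p_ge0 : forall a, 0 <= p a.

(** The product topology makes Tychonoff's theorem available. Column sums are left free, and [cost]
    penalises their deviation from [c]. *)
Let plan := prod_topology (fun _ : (A * B)%type => R : topologicalType).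
Let excess (f : plan) (b : B) : R := \sum_a f (a, b) - c b.
Let cost (f : plan) : R := \sum_b excess f b ^+ 2.

Let feasible : set plan :=
  [set f : plan | forall ab, 0 <= f ab <= if e ab.1 ab.2 then p ab.1 else 0] `&`
  [set f : plan | forall a, \sum_b f (a, b) = p a].

Let coord_continuous (ab : A * B) : continuous (fun f : plan => f ab).
Proof. exact: (@proj_continuous _ (fun _ : (A * B)%type => R : topologicalType) ab). Qed.

Let cost_continuous : continuous cost.
Proof.
apply: sum_continuous => b; apply: sqr_sub_continuous; apply: sum_continuous => a.
exact: coord_continuous.
Qed.

(** The entry bounds cut out a product of segments, compact by Tychonoff; each row condition is
    closed. *)
Let feasible_compact : compact feasible.
Proof.
apply: compact_closedI.
  rewrite (_ : [set _ | _] = [set f : plan |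
      forall ab, `[0, if e ab.1 ab.2 then p ab.1 else 0]%classic (f ab)]).
    exact: (@tychonoff _ (fun _ : (A * B)%type => R : topologicalType)
      (fun ab => `[0, if e ab.1 ab.2 then p ab.1 else 0]%classic)
      (fun ab => @segment_compact _ _ _)).
  by apply/seteqP; split=> f /= f_box ab; move: (f_box ab); rewrite in_itv.
rewrite (_ : [set _ | _] =
  \bigcap_(a in setT) ((fun f : plan => \sum_b f (a, b)) @^-1` [set p a])).
  apply: closed_bigI => a _; apply: closed_comp.
    by move=> f _; apply: sum_continuous => b; exact: coord_continuous.
  exact: closed_eq.
by apply/seteqP; split=> f /= f_row a; move: (f_row a) => //; apply.
Qed.

(** Each row sends its whole mass to one neighbour; a row without neighbours has mass zero. *)
Let feasible_neq0 : (forall a, 0 < p a -> exists b, e a b) -> feasible !=set0.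
Proof.
move=> nbr.
exists (fun ab => if [pick b | e ab.1 b] == Some ab.2 then p ab.1 else 0); split=> [[a b]|a] /=.
  have box0 : 0 <= (0 : R) <= if e a b then p a else 0.
    by rewrite lexx /=; case: ifP => _; rewrite ?p_ge0.
  case: pickP => [b' eab'|_ //].
  by case: eqP => [[<-]|_ //]; rewrite eab' lexx p_ge0.
case: pickP => [b eab|noe].
  rewrite (bigD1 b) //= eqxx big1 ?addr0 // => b' /negbTE b'b.
  by case: eqP => [[/esym/eqP]|//]; rewrite b'b.
rewrite big1 //; apply/esym/eqP; rewrite eq_le p_ge0 andbT leNgt.
by apply/negP => /nbr [b]; rewrite noe.
Qed.

(* Shifting a small mass [t] of row [a] from [b] to [b'] changes the cost by
   [2 t (t - (excess b - excess b'))]. *)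
Let shift_mass (f : plan) (a : A) (b b' : B) :
    feasible f -> (forall g, feasible g -> cost f <= cost g) ->
  0 < f (a, b) -> e a b' -> excess f b <= excess f b'.
Proof.
move=> [/= f_box f_row] f_min fab eab'; rewrite leNgt; apply/negP => lt_exc.
have neq_bb' : b != b' by apply: contraTneq lt_exc => ->; rewrite ltxx.
have neq_b'b : b' != b by rewrite eq_sym.
(* The first bound keeps [g] nonnegative; the second, half the gap between the excesses, keeps [t]
   below the gap, so that the cost strictly drops. *)
pose t := Num.min (f (a, b)) ((excess f b - excess f b') / 2).
have t_gt0 : 0 < t by rewrite lt_min fab /= divr_gt0 // subr_gt0.
have t_le : t <= f (a, b) by rewrite ge_min lexx.
have t_lt : t < excess f b - excess f b'.
  rewrite gt_min; apply/orP; right; lra.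
pose s (y : B) : R := (y == b')%:R - (y == b)%:R.
pose g : plan := fun ab => f ab + (ab.1 == a)%:R * (t * s ab.2).
have sb : s b = -1 by rewrite /s eqxx (negbTE neq_bb') sub0r.
have sb' : s b' = 1 by rewrite /s eqxx (negbTE neq_b'b) subr0.
have sum_s (h : B -> R) : \sum_y h y * s y = h b' - h b.
  rewrite (bigD1 b) //= (bigD1 b') 1?eq_sym //= big1.
    by rewrite sb sb'; ring.
  by move=> y /andP[/negbTE yb /negbTE yb']; rewrite /s yb yb' subr0 mulr0.
have g_row x : \sum_y g (x, y) = p x.
  rewrite big_split /= f_row -mulr_sumr.
  by rewrite (_ : \sum_i t * s i = 0) ?mulr0 ?addr0 // (sum_s (fun=> t)) subrr.
have g_ge0 x y : 0 <= g (x, y).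
  rewrite /g /=; case: eqP => [->|_]; last first.
    by rewrite mul0r addr0; case/andP: (f_box (x, y)).
  rewrite mul1r; have [->|/negbTE nyb] := eqVneq y b.
    by rewrite sb mulrN1 subr_ge0.
  rewrite /s nyb.
  case/andP: (f_box (a, y)) => f_ge0 _.
  by case: (y == b'); rewrite subr0 ?mulr1 ?mulr0 ?addr0 // addr_ge0 // ltW.
have g_feas : feasible g.
  split=> [[x y]|x] /=; last exact: g_row.
  rewrite g_ge0 /=; case: ifPn => [exy|nexy].
    rewrite -(g_row x) (bigD1 y) //= lerDl sumr_ge0 // => z _; exact: g_ge0.
  have := f_box (x, y); rewrite /= (negbTE nexy) /g /=.
  case: eqP => [xa|_]; last by rewrite mul0r addr0 => /andP[].
  rewrite xa in nexy *; have [yb|nyb] := eqVneq y b.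
    by move=> /andP[_]; rewrite yb leNgt fab.
  rewrite /s (negbTE nyb); have [yb'|_] := eqVneq y b'.
    by rewrite yb' eab' in nexy.
  by rewrite subr0 !mulr0 addr0 => /andP[].
have exc_g y : excess g y = excess f y + t * s y.
  rewrite /excess big_split /= -addrA [X in _ + X = _]addrC addrA; congr (_ - _ + _).
  rewrite (bigD1 a) //= eqxx mul1r big1 ?addr0 // => x /negbTE ->.
  by rewrite mul0r.
have cost_g : cost g = cost f + t * (excess f b' - excess f b) *+ 2 + t ^+ 2 * 2.
  rewrite /cost -(sum_s (excess f)) mulr_sumr -sumrMnl.
  have -> : t ^+ 2 * 2 = \sum_y t ^+ 2 * s y * s y.
    rewrite (sum_s (fun y => t ^+ 2 * s y)) sb sb'; ring.
  rewrite -!big_split /=; apply: eq_bigr => y _; rewrite exc_g; ring.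
have := f_min g g_feas; rewrite cost_g; nra.
Qed.

(* A plan minimising the squared excesses has none: the set [W] of columns with
   positive excess absorbs every row that sends mass to it, so by Hall's
   condition its total excess is nonpositive. *)
Lemma weighted_hall :
  \sum_a p a = \sum_b c b ->
  (forall W : {set B},
    \sum_(a | [forall b, e a b ==> (b \in W)]) p a <= \sum_(b in W) c b) ->
  exists f : A -> B -> R,
    [/\ forall a b, 0 <= f a b, forall a b, ~~ e a b -> f a b = 0,
        forall a, \sum_b f a b = p a & forall b, \sum_a f a b = c b].
Proof.
move=> total hall.
(* Hall's condition for the empty set: a row without neighbours carries no mass. *)
have nbr a : 0 < p a -> exists b, e a b.
  move=> pa; apply/existsP; apply: contraPT (hall finset.set0) => /existsPn noe.
  rewrite big_set0; apply/negP; rewrite -ltNge; apply: lt_le_trans pa _.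
  rewrite (bigD1 a) /= ?lerDl ?sumr_ge0 //.
  by apply/forallP => b; rewrite (negbTE (noe b)).
have [f /set_mem f_feas f_min] := compact_EVT_min (feasible_neq0 nbr) feasible_compact
  (continuous_subspaceT cost_continuous).
have {}f_min g : feasible g -> cost f <= cost g by move=> /mem_set; exact: f_min.
have shift := (fun a b b' => @shift_mass f a b b' f_feas f_min).
have [/= f_box f_row] := f_feas.
pose W := [set b | 0 < excess f b]%SET.
(* A row with a neighbour outside [W] sends nothing into [W]: otherwise [shift] would make the
   excess at that neighbour positive. What [W] receives thus comes from rows with all neighbours in
   [W], whose mass Hall's condition bounds. *)
have W_mass : \sum_(b in W) \sum_a f (a, b) <= \sum_(b in W) c b.
  apply: le_trans (hall W); rewrite exchange_big /=.
  rewrite [leRHS]big_mkcond /=; apply: ler_sum => a _.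
  case: ifPn => [_|/forallPn [b']].
    rewrite -f_row [leRHS](bigID (mem W)) /= lerDl sumr_ge0 // => b _.
    by case/andP: (f_box (a, b)).
  rewrite negb_imply inE => /andP[eab' exc_b']; rewrite big1 // => b.
  rewrite inE => exc_b; apply/eqP; rewrite eq_le.
  case/andP: (f_box (a, b)) => -> _; rewrite andbT leNgt.
  apply: contra exc_b' => fab; exact: lt_le_trans exc_b (shift _ _ _ fab eab').
have exc_le0 b : excess f b <= 0.
  rewrite leNgt; apply/negP => exc_b.
  have : 0 < \sum_(b in W) excess f b.
    rewrite (bigD1 b) ?inE //=; apply: ltr_wpDr => //; apply: sumr_ge0 => b'.
    by rewrite inE => /andP[/ltW].
  by rewrite sumrB subr_gt0 ltNge W_mass.
(* No excess is positive and by [total] they sum to zero, so each vanishes. *)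
have sum_exc : \sum_b (- excess f b) = 0.
  rewrite sumrN sumrB exchange_big /=; under eq_bigr do rewrite f_row.
  by rewrite total subrr oppr0.
exists (fun a b => f (a, b)); split=> [a b|a b /negbTE neab|//|b].
- by case/andP: (f_box (a, b)).
- by apply/eqP; have := f_box (a, b); rewrite /= neab eq_le andbC.
- have /eqP := sum_exc; rewrite psumr_eq0; last by move=> y _; rewrite oppr_ge0.
  by move=> /allP/(_ b (mem_index_enum _)); rewrite /= oppr_eq0 subr_eq0 => /eqP.
Qed.

End WeightedHall.

(* Measurable types are pointed, hence the distinguished element. *)
Definition discrete_space (W : finType) (w0 : W) : Type := W.

(** * Finite probability spaces in which every set is measurable *)

Section DiscreteSpace.
Local Open Scope classical_set_scope.
Context (W : finType) (w0 : W).
Notation Om := (discrete_space w0).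

HB.instance Definition _ := Finite.on Om.
HB.instance Definition _ := isPointed.Build Om (w0 : Om).

HB.instance Definition _ := @isMeasurable.Build default_measure_display Om
  discrete_measurable discrete_measurable0 discrete_measurableC discrete_measurableU.

Lemma discrete_space_measurable (A : set Om) : measurable A.
Proof. by []. Qed.

Lemma discrete_space_measurable_fun (d : measure_display) (T : measurableType d)
    (D : set Om) (f : Om -> T) : measurable_fun D f.
Proof. by []. Qed.

Context (R : realType) (wt : W -> R).
Hypothesis wt_ge0 : forall w, 0 <= wt w.
Hypothesis wt_sum1 : \sum_w wt w = 1.

(** [msum] adds a sequence of measures, so the points of [W] are numbered through [enum W], with
    [w0] as the default of [nth]. *)
Let atoms : nat -> {measure set Om -> \bar R} := fun n =>
  mscale (NngNum (wt_ge0 (nth w0 (enum W) n))) (dirac (nth w0 (enum W) n : Om)).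

Definition weighted_measure : set Om -> \bar R := msum atoms (size (enum W)).

HB.instance Definition _ := Measure.on weighted_measure.

Let sum_atoms (F : W -> \bar R) :
  (\sum_(n < size (enum W)) F (nth w0 (enum W) n) = \sum_w F w)%E.
Proof.
rewrite -(big_mkord predT (fun n => F (nth w0 (enum W) n))).
by rewrite -(big_nth w0 predT F) big_enum.
Qed.

Lemma weighted_measureE (A : set Om) :
  weighted_measure A = (\sum_(w : W | (w : Om) \in A) wt w)%:E.
Proof.
rewrite /weighted_measure /msum /atoms /=.
rewrite (sum_atoms (fun w => (wt w)%:E * \d_(w : Om) A)%E).
rewrite -sumEFin [RHS]big_mkcond /=; apply: eq_bigr => w _.
by rewrite diracE; case: ifP; rewrite ?mule1 ?mule0.
Qed.

Let weighted_measureT : weighted_measure [set: Om] = 1%E.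
Proof.
rewrite weighted_measureE -[X in _ = X%:E]wt_sum1; congr (_%:E).
by apply: eq_bigl => w; rewrite in_setT.
Qed.

HB.instance Definition _ :=
  Measure_isProbability.Build _ _ _ weighted_measure weighted_measureT.

Definition weighted_prob : probability Om R := weighted_measure.

Lemma weighted_probE (A : set Om) (p : pred W) :
  (forall w, A w <-> p w) -> weighted_prob A = (\sum_(w | p w) wt w)%:E.
Proof.
move=> Ap; rewrite [LHS]weighted_measureE; congr (_%:E); apply: eq_bigl => w.
by apply/idP/idP => [/set_mem/Ap|/Ap/mem_set].
Qed.

Lemma integral_weighted_prob (A : set Om) (p : pred W) (f : W -> R) :
  (forall w, A w <-> p w) -> (forall w, 0 <= f w) ->
  (\int[weighted_prob]_(w in A) (f w)%:E = (\sum_(w | p w) wt w * f w)%:E)%E.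
Proof.
move=> Ap f0.
rewrite [LHS]ge0_integral_measure_sum //; last by move=> w _; rewrite lee_fin.
under eq_bigr => n _.
  rewrite ge0_integral_mscale //; last by move=> w _; rewrite lee_fin.
  rewrite integral_dirac //=; over.
rewrite (sum_atoms (fun w => (wt w)%:E * (\d_(w : Om) A * (f w)%:E))%E).
rewrite -sumEFin [RHS]big_mkcond /=; apply: eq_bigr => w _; rewrite diracE.
have -> : (w \in A) = p w by apply/idP/idP => [/set_mem/Ap|/Ap/mem_set].
by case: (p w); rewrite ?mul1e ?mul0e ?mule0.
Qed.

End DiscreteSpace.

(** * Sufficiency: transport kernels and a realization of the models *)

Lemma coupling_of_ineqs (R : realType) (M K Q : nat)
    (Pm : {ffun 'I_K -> 'I_M} -> R) (Pc : 'I_Q -> 'I_K -> 'I_M -> R) (q : 'I_Q) :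
    (forall a, 0 <= Pm a) -> \sum_a Pm a = 1 ->
    (forall k m, 0 <= Pc q k m) -> \sum_(k < K) \sum_(m < M) Pc q k m = 1 ->
    ineqs_hold Pm Pc ->
  exists f : {ffun 'I_K -> 'I_M} -> 'I_K -> R,
    [/\ forall a k, 0 <= f a k, forall a, \sum_k f a k = Pm a &
        forall k m, \sum_(a : {ffun 'I_K -> 'I_M} | a k == m) f a k = Pc q k m].
Proof.
move=> Pm_ge0 Pm_sum1 Pc_ge0 Pc_sum1 ineqs.
pose e (a : {ffun 'I_K -> 'I_M}) (b : 'I_K * 'I_M) := a b.1 == b.2.
pose c (b : 'I_K * 'I_M) := Pc q b.1 b.2.
have sum_c : \sum_b c b = 1.
  by rewrite -Pc_sum1 pair_big.
have [||f [f_ge0 f_supp f_row f_col]] := @weighted_hall R _ _ e Pm c Pm_ge0.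
- by rewrite sum_c.
- move=> W; pose V k := [set m | (k, m) \in W]%SET.
  have prodE a : [forall b, e a b ==> (b \in W)] = [forall k, a k \in V k].
    apply/forallP/forallP => [aW k|aV [k m]].
      by have := aW (k, a k); rewrite /e /= eqxx inE.
    by apply/implyP => /eqP /= <-; have := aV k; rewrite inE.
  rewrite (eq_bigl _ _ prodE).
  have cW : \sum_(b in W) c b = \sum_(k < K) \sum_(m in V k) Pc q k m.
    rewrite pair_big_dep /=; apply: eq_big => [[k m]|[k m] _] //=.
    by rewrite inE.
  rewrite cW.
  (* [ineqs] covers boxes with nonempty sides, not all full. An empty side makes the left sum empty;
     if all sides are full, the right-hand side is the total mass 1. *)
  have [/existsP [k /eqP Vk]|/existsPn V_neq0] := boolP [exists k, V k == finset.set0].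
    rewrite big1; last by move=> a /forallP /(_ k); rewrite Vk inE.
    by apply: sumr_ge0 => k' _; apply: sumr_ge0.
  have [/existsP V_neqT|/existsPn V_T] := boolP [exists k, V k != [set: 'I_M]%SET].
    exact: ineqs.
  have {}V_T k : V k = [set: 'I_M]%SET by apply/eqP; rewrite -[_ == _]negbK V_T.
  rewrite (_ : \sum_(k < K) _ = 1).
    by rewrite -Pm_sum1 [leRHS](bigID (fun a : {ffun 'I_K -> 'I_M} => [forall k, a k \in V k]))
      lerDl sumr_ge0.
  by rewrite -Pc_sum1; apply: eq_bigr => k _; apply: eq_bigl => m; rewrite V_T inE.
(* The row of [a] is supported on the pairs [(k, a k)], so these entries keep its whole mass. *)
exists (fun a k => f a (k, a k)); split=> [a k|a|k m] //.
- rewrite -f_row (eq_bigr (fun b => f a (b.1, b.2))); last by case.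
  rewrite -(pair_bigA _ (fun k m => f a (k, m))) /=; apply: eq_bigr => k _.
  rewrite (bigD1 (a k)) //= big1 ?addr0 // => m neq_m.
  by rewrite f_supp // /e /= eq_sym.
- rewrite -[RHS](f_col (k, m)) [RHS](bigID (fun a => e a (k, m))) /=.
  rewrite [X in _ = _ + X]big1 ?addr0; last by move=> a; exact: f_supp.
  by apply: eq_bigr => a /eqP <-.
Qed.

Lemma kernel_of_ineqs (R : realType) (M K Q : nat)
    (Pm : {ffun 'I_K -> 'I_M} -> R) (Pc : 'I_Q -> 'I_K -> 'I_M -> R) :
    (0 < K)%N ->
    (forall a, 0 <= Pm a) -> \sum_a Pm a = 1 ->
    (forall q k m, 0 <= Pc q k m) ->
    (forall q, \sum_(k < K) \sum_(m < M) Pc q k m = 1) ->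
    ineqs_hold Pm Pc ->
  exists kap : 'I_Q -> {ffun 'I_K -> 'I_M} -> 'I_K -> R,
    [/\ forall q a k, 0 <= kap q a k, forall q a, \sum_k kap q a k = 1 &
        forall q k m,
          \sum_(a : {ffun 'I_K -> 'I_M} | a k == m) Pm a * kap q a k = Pc q k m].
Proof.
move=> K_gt0 Pm_ge0 Pm_sum1 Pc_ge0 Pc_sum1 ineqs.
suff kernel q : exists kap : {ffun 'I_K -> 'I_M} -> 'I_K -> R,
    [/\ forall a k, 0 <= kap a k, forall a, \sum_k kap a k = 1 &
        forall k m, \sum_(a : {ffun 'I_K -> 'I_M} | a k == m) Pm a * kap a k = Pc q k m].
  have [kap kapP] := choice kernel.
  by exists kap; split=> q; case: (kapP q).
have [f [f_ge0 f_row f_col]] :=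
  coupling_of_ineqs Pm_ge0 Pm_sum1 (Pc_ge0 q) (Pc_sum1 q) ineqs.
(* Conditioning the coupling on [a]. Where [Pm a] is zero the row of [f] vanishes too, and the point
   mass at treatment 0 is a default. *)
exists (fun a k => if Pm a == 0 then (k == Ordinal K_gt0)%:R else f a k / Pm a).
split=> [a k|a|k m].
- by case: ifP => _; rewrite ?ler0n // divr_ge0.
- case: eqP => [_|/eqP Pm_a]; last by rewrite -mulr_suml f_row divff.
  by rewrite (bigD1 (Ordinal K_gt0)) //= big1 ?addr0 // => k /negbTE ->.
- rewrite -f_col; apply: eq_bigr => a _; case: eqP => [Pm_a|/eqP Pm_a]; last first.
    by rewrite mulrC divfK.
  rewrite Pm_a mul0r; apply/esym/eqP.
  have /eqP := f_row a; rewrite Pm_a psumr_eq0 //.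
  by move=> /allP /(_ k (mem_index_enum _)).
Qed.

(* The potential treatments [X(z)], [z < Q], are drawn independently of each
   other given the vector of potential outcomes, each one from [kap z]; the
   instrument is uniform and independent of everything. *)
Section Realization.
Local Open Scope classical_set_scope.
Context (R : realType) (M K Q : nat).
Context (k0 : 'I_K) (q0 : 'I_Q) (a0 : {ffun 'I_K -> 'I_M}).
Context (Pm : {ffun 'I_K -> 'I_M} -> R) (Pc : 'I_Q -> 'I_K -> 'I_M -> R).
Context (kap : 'I_Q -> {ffun 'I_K -> 'I_M} -> 'I_K -> R).
Hypothesis Pm_ge0 : forall a, 0 <= Pm a.
Hypothesis Pm_sum1 : \sum_a Pm a = 1.
Hypothesis kap_ge0 : forall q a k, 0 <= kap q a k.
Hypothesis kap_sum1 : forall q a, \sum_k kap q a k = 1.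
Hypothesis kap_col : forall q k m,
  \sum_(a : {ffun 'I_K -> 'I_M} | a k == m) Pm a * kap q a k = Pc q k m.

Let AB := ({ffun 'I_K -> 'I_M} * {ffun 'I_Q -> 'I_K})%type.
Let W := ('I_Q * AB)%type.
Let v (ab : AB) : R := Pm ab.1 * \prod_z kap z ab.1 (ab.2 z).
Let wt (w : W) : R := Q%:R^-1 * v w.2.

Let v_ge0 ab : 0 <= v ab.
Proof. by rewrite mulr_ge0 // prodr_ge0. Qed.

Let wt_ge0 w : 0 <= wt w.
Proof. by rewrite mulr_ge0 // invr_ge0 ler0n. Qed.

Let Q_neq0 : (Q%:R : R) != 0.
Proof. by rewrite pnatr_eq0 -lt0n; apply: leq_ltn_trans (ltn_ord q0). Qed.

(** By distributivity the sum over treatment vectors of a product is a product of sums, each equal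
    to 1 by [kap_sum1]: the potential treatments integrate out. *)
Let sum_v_mul (p : pred {ffun 'I_K -> 'I_M}) (f : {ffun 'I_K -> 'I_M} -> R) :
  \sum_(ab : AB | p ab.1) v ab * f ab.1 = \sum_(a | p a) Pm a * f a.
Proof.
rewrite (eq_bigl (fun ab : AB => p ab.1 && predT ab.2)); last by move=> ab; rewrite andbT.
rewrite -(pair_big p predT (fun a b => v (a, b) * f a)) /=; apply: eq_bigr => a _.
rewrite /v /= -mulr_suml -mulr_sumr -(bigA_distr_bigA (fun z k => kap z a k)).
by rewrite big1 ?mulr1.
Qed.

Let sum_v (p : pred {ffun 'I_K -> 'I_M}) :
  \sum_(ab : AB | p ab.1) v ab = \sum_(a | p a) Pm a.
Proof.
have := sum_v_mul p (fun=> 1); under eq_bigr do rewrite mulr1.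
by move=> ->; under eq_bigr do rewrite mulr1.
Qed.

Let sum_v_treated (p : pred {ffun 'I_K -> 'I_M}) (q : 'I_Q) (k : 'I_K) :
  \sum_(ab : AB | p ab.1 && (ab.2 q == k)) v ab = \sum_(a | p a) Pm a * kap q a k.
Proof.
rewrite -(pair_big p (fun b : {ffun 'I_Q -> 'I_K} => b q == k) (fun a b => v (a, b))) /=.
apply: eq_bigr => a _; rewrite /v /= -mulr_sumr; congr (_ * _).
(* [D] constrains coordinate [q] alone: after distributing, its factor is [kap q a k] and every
   other factor is 1. *)
pose D (z : 'I_Q) : pred 'I_K := fun k' => (z == q) ==> (k' == k).
transitivity (\sum_(b in family D) \prod_z kap z a (b z)).
  apply: eq_bigl => b; apply/eqP/familyP => [bq z|/(_ q)].
    by rewrite unfold_in; apply/implyP => /eqP ->; rewrite bq.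
  by rewrite unfold_in /D eqxx => /eqP.
rewrite -(bigA_distr_big_dep D (fun z k' => kap z a k')) (bigD1 q) //= [X in _ * X]big1 ?mulr1.
  by rewrite (eq_bigl (pred1 k)) ?big_pred1_eq // => k'; rewrite /D eqxx.
move=> z zq; rewrite -(kap_sum1 z a); apply: eq_bigl => k'.
by rewrite /D (negbTE zq).
Qed.

Let sum_wt_mul (p : pred AB) (f : AB -> R) :
  \sum_(w : W | p w.2) wt w * f w.2 = \sum_(ab | p ab) v ab * f ab.
Proof.
rewrite -(pair_big predT p (fun q ab => wt (q, ab) * f ab)) /= /wt /=.
rewrite exchange_big /=; apply: eq_bigr => ab _.
by rewrite sumr_const card_ord -[LHS]mulr_natl !mulrA divff // mul1r.
Qed.

Let sum_wt (p : pred AB) : \sum_(w : W | p w.2) wt w = \sum_(ab | p ab) v ab.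
Proof.
have := sum_wt_mul p (fun=> 1); under eq_bigr do rewrite mulr1.
by move=> ->; under eq_bigr do rewrite mulr1.
Qed.

Let sum_wt_instrument (q : 'I_Q) (p : pred AB) :
  \sum_(w : W | (w.1 == q) && p w.2) wt w = Q%:R^-1 * \sum_(ab | p ab) v ab.
Proof.
rewrite -(pair_big (pred1 q) p (fun q ab => wt (q, ab))) /= big_pred1_eq.
by rewrite /wt /= -mulr_sumr.
Qed.

Let wt_sum1 : \sum_w wt w = 1.
Proof. by rewrite (sum_wt predT) (sum_v predT). Qed.

Let Om := discrete_space ((q0, (a0, [ffun=> k0])) : W).
Let P : probability Om R := weighted_prob (q0, (a0, [ffun=> k0])) wt_ge0 wt_sum1.
Let Z (w : Om) : 'I_Q := (w : W).1.
Let A (w : Om) : {ffun 'I_K -> 'I_M} := (w : W).2.1.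
Let Xpo (z : 'I_Q) (w : Om) : 'I_K := (w : W).2.2 z.
Let X (w : Om) : 'I_K := Xpo (Z w) w.
Let Ypo (i : 'I_K) (z : 'I_Q) (w : Om) : 'I_M := A w i.

(** The weight [wt] is constant in the instrument. The resulting independence from every event on
    the other components serves all the independence assumptions. *)
Let P_instrument (q : 'I_Q) (S : AB -> Prop) :
  P [set w | Z w = q /\ S (w : W).2] = ((Q%:R^-1)%:E * P [set w | S (w : W).2])%E.
Proof.
rewrite (@weighted_probE _ _ _ _ wt_ge0 wt_sum1 _
  (fun w : W => (w.1 == q) && `[< S w.2 >])); last first.
  by move=> w; split=> [[/eqP -> /asboolP]|/andP[/eqP <- /asboolP]].
rewrite (@weighted_probE _ _ _ _ wt_ge0 wt_sum1 _ (fun w : W => `[< S w.2 >])); last first.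
  by move=> w; split=> /asboolP.
by rewrite (sum_wt_instrument q (fun ab => `[< S ab >])) (sum_wt (fun ab => `[< S ab >])).
Qed.

Let P_Z (q : 'I_Q) : P [set w | Z w = q] = (Q%:R^-1)%:E.
Proof.
rewrite (_ : [set w | Z w = q] = [set w | Z w = q /\ True]).
  by rewrite (P_instrument q (fun=> True)) probability_setT mule1.
by apply/seteqP; split=> w //= [].
Qed.

Let P_indep (q : 'I_Q) (S : AB -> Prop) :
  P [set w | Z w = q /\ S (w : W).2] = (P [set w | Z w = q] * P [set w | S (w : W).2])%E.
Proof. by rewrite P_Z; exact: P_instrument. Qed.

Let P_outcomes (S : set {ffun 'I_K -> 'I_M}) (p : pred {ffun 'I_K -> 'I_M}) :
  (forall a, S a <-> p a) -> P [set w | S (A w)] = (\sum_(a | p a) Pm a)%:E.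
Proof.
move=> Sp; rewrite (@weighted_probE _ _ _ _ wt_ge0 wt_sum1 _ (fun w : W => p w.2.1)).
  by rewrite (sum_wt (fun ab => p ab.1)) sum_v.
by move=> w; exact: Sp.
Qed.

Let P_treated (q : 'I_Q) (k : 'I_K) (S : set {ffun 'I_K -> 'I_M})
    (p : pred {ffun 'I_K -> 'I_M}) :
  (forall a, S a <-> p a) ->
  P [set w | Z w = q /\ X w = k /\ S (A w)] =
  (Q%:R^-1 * \sum_(a | p a) Pm a * kap q a k)%:E.
Proof.
move=> Sp; rewrite (@weighted_probE _ _ _ _ wt_ge0 wt_sum1 _
  (fun w : W => (w.1 == q) && (p w.2.1 && (w.2.2 q == k)))).
  by rewrite (sum_wt_instrument q (fun ab => p ab.1 && (ab.2 q == k))) sum_v_treated.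
move=> [z [a b]]; rewrite /Z /X /Xpo /A /=; split.
  by move=> [-> [-> /Sp ->]]; rewrite !eqxx.
by move=> /and3P[/eqP -> /Sp ? /eqP ->].
Qed.

Let integral_outcomes (S : set {ffun 'I_K -> 'I_M}) (p : pred {ffun 'I_K -> 'I_M})
    (f : {ffun 'I_K -> 'I_M} -> R) :
  (forall a, S a <-> p a) -> (forall a, 0 <= f a) ->
  (\int[P]_(w in [set w | S (A w)]) (f (A w))%:E = (\sum_(a | p a) Pm a * f a)%:E)%E.
Proof.
move=> Sp f_ge0.
rewrite (@integral_weighted_prob _ _ _ _ wt_ge0 wt_sum1 _ (fun w : W => p w.2.1)
  (fun w => f w.2.1)) //.
  by rewrite (sum_wt_mul (fun ab => p ab.1) (fun ab => f ab.1)) sum_v_mul.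
by move=> w; exact: Sp.
Qed.

Let realization_excl_E1 : excl_E1 P Ypo.
Proof.
move=> i z z'; rewrite (_ : [set _ | _] = set0) ?measure0 //.
by apply/seteqP; split=> w.
Qed.

Let realization_indep_I2 : indep_I2 P Z Ypo.
Proof. move=> q a; exact: (P_indep q (fun ab => forall i z, ab.1 i = a (i, z))). Qed.

Let latent := discrete_space a0.
Let U (w : Om) : latent := A w.

Let kap_le1 q a k : kap q a k <= 1.
Proof. by rewrite -(kap_sum1 q a) (bigD1 k) //= lerDl sumr_ge0. Qed.

(** The latent vector determines every potential outcome, so the conditional probability is an
    indicator. *)
Let cprob_outcome (i : 'I_K) (z : 'I_Q) (m : 'I_M) :
  cprob_version P U [set w | Ypo i z w = m] (fun a : latent => ((a : {ffun _}) i == m)%:R).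
Proof.
split; first exact: discrete_space_measurable_fun.
split=> [a|S _]; first by case: eqP; rewrite lexx ler01.
have SP a : S a <-> `[< S a >] by split=> /asboolP.
rewrite [RHS](integral_outcomes (f := fun a => (a i == m)%:R) SP); last first.
  by move=> a; rewrite ler0n.
rewrite [LHS](@P_outcomes ([set a : {ffun 'I_K -> 'I_M} | a i = m] `&` S)
  (fun a => `[< S a >] && (a i == m))); last first.
  by move=> a; split=> [[/eqP -> /asboolP ->]|/andP[/asboolP ? /eqP]].
by congr (_%:E); rewrite big_mkcondr; apply: eq_bigr => a _; case: eqP; rewrite ?mulr1 ?mulr0.
Qed.

(** Given the latent vector [a], the instrument is uniform and the treatment at [q] follows
    [kap q a]. Taking [B] full gives the law of [(X, Z)]; taking [B] to be an outcome event gives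
    the joint law, visibly a product. *)
Let cprob_joint (B : pred {ffun 'I_K -> 'I_M}) (q : 'I_Q) (k : 'I_K) :
  cprob_version P U [set w | B (A w) /\ (X w, Z w) = (k, q)]
    (fun a : latent => (B a)%:R * (Q%:R^-1 * kap q a k)).
Proof.
have Qinv_ge0 : 0 <= Q%:R^-1 :> R by rewrite invr_ge0 ler0n.
split; first exact: discrete_space_measurable_fun.
split=> [a|S _].
  rewrite !mulr_ge0 ?ler0n //= -[leRHS]mulr1 ler_pM ?ler0n ?mulr_ge0 //.
    by case: (B a).
  rewrite -[leRHS]mulr1 ler_pM // invf_le1 ?ltr0n ?ler1n.
    exact: leq_ltn_trans (ltn_ord q0).
  exact: leq_ltn_trans (ltn_ord q0).
have SP a : S a <-> `[< S a >] by split=> /asboolP.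
rewrite [RHS](integral_outcomes (f := fun a => (B a)%:R * (Q%:R^-1 * kap q a k)) SP);
  last by move=> a; rewrite !mulr_ge0 ?ler0n.
transitivity (P [set w | Z w = q /\ X w = k /\ (S `&` [set a | B a]) (A w)]).
  congr (P _); apply/seteqP; split=> w /=.
    by move=> [[Bw [-> ->]] ?].
  by move=> [-> [-> [? ?]]].
rewrite (@P_treated _ _ _ (fun a => `[< S a >] && B a)); last first.
  by move=> a; split=> [[/asboolP -> ->]|/andP[/asboolP]].
congr (_%:E); rewrite mulr_sumr big_mkcondr; apply: eq_bigr => a _.
by case: (B a); rewrite ?mul1r ?mul0r ?mulr0 // mulrCA.
Qed.

Let realization_Mod5 : model_holds P Z X Ypo Xpo Mod5.
Proof.
exists _, latent, U; split.
- exact: discrete_space_measurable_fun.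
- move=> i z z' m; exists (fun a : latent => ((a : {ffun _}) i == m)%:R).
  by split; exact: cprob_outcome.
split=> [S q _|i z m [k q]].
  rewrite setIC muleC; exact: (P_indep q (fun ab => S ab.1)).
exists (fun a : latent => ((a : {ffun _}) i == m)%:R), (fun a : latent => Q%:R^-1 * kap q a k).
split; first exact: cprob_outcome.
- have := cprob_joint predT q k; rewrite (_ : [set _ | _ /\ _] = [set w | (X w, Z w) = (k, q)]).
    by under [X in cprob_version _ _ _ X -> _]eq_fun do rewrite mul1r.
  by apply/seteqP; split=> w //= [].
- have := cprob_joint (fun a : {ffun 'I_K -> 'I_M} => a i == m) q k.
  rewrite (_ : [set _ | _ /\ _] = [set w | Ypo i z w = m /\ (X w, Z w) = (k, q)]) //.
  by apply/seteqP; split=> w /= [/eqP].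
Qed.

Lemma realization (mdl : IVmodel) : compatible mdl Pm Pc.
Proof.
exists _, Om, P, Z, X, Ypo, Xpo; split.
  by split=> *; move=> ?; exact: discrete_space_measurable.
split.
  (* [Mod2], [Mod3] and [Mod5] close at once; E2 holds by conversion, as [Ypo] ignores [z]. [Mod1]
     and [Mod4] remain. *)
  case: mdl => //.
  - split=> //; split=> // q a b.
    exact: (P_indep q (fun ab => (forall i z, ab.1 i = a (i, z)) /\ (forall z, ab.2 z = b z))).
  - split=> //; split=> // z i q k m.
    exact: (P_indep q (fun ab => ab.2 z = k /\ ab.1 i = m)).
split; first by move=> q; rewrite P_Z lte_fin invr_gt0 lt_neqAle eq_sym Q_neq0 ler0n.
split=> [a|q k m].
  rewrite (@P_outcomes [set a' : {ffun 'I_K -> 'I_M} | forall i, a' i = a i] (pred1 a)).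
    by rewrite big_pred1_eq.
  by move=> a'; split=> [/ffunP ->|/eqP ->] //=; rewrite eqxx.
rewrite P_Z -EFinM -kap_col mulrC.
rewrite -(@P_treated q k [set a : {ffun 'I_K -> 'I_M} | a k = m]); last by move=> a; split=> /eqP.
congr (P _); apply/seteqP; split=> w /=; rewrite /Yobs /Ypo; first by move=> [-> [<- ?]].
by move=> [-> [<- ?]].
Qed.

End Realization.

(** * Laws of finite-valued random variables *)

Section FiniteLaw.
Local Open Scope classical_set_scope.
Context (R : realType) (d : measure_display) (Om : measurableType d).
Context (P : probability Om R).

Lemma fin_rv_measurable (A : finType) (F : Om -> A) (p : pred A) :
  fin_rv F -> measurable [set w | p (F w)].
Proof.
move=> mF; rewrite (_ : [set _ | _] = \bigcup_(a in [set a | p a]) (F @^-1` [set a])).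
  by apply: fin_bigcup_measurable => // a _; exact: mF.
by apply/seteqP; split=> [w pw|w [a pa] /= ->] //; exists (F w).
Qed.

Lemma fin_rv_pair (A B : finType) (F : Om -> A) (G : Om -> B) :
  fin_rv F -> fin_rv G -> fin_rv (fun w => (F w, G w)).
Proof.
move=> mF mG [a b]; rewrite (_ : _ @^-1` _ = F @^-1` [set a] `&` G @^-1` [set b]).
  by apply: measurableI; [exact: mF | exact: mG].
by apply/seteqP; split=> w /= [-> ->].
Qed.

Lemma fin_rv_ffun (I A : finType) (F : I -> Om -> A) :
  (forall i, fin_rv (F i)) -> fin_rv (fun w => [ffun i => F i w]).
Proof.
move=> mF f; rewrite (_ : _ @^-1` _ = \bigcap_(i in [set: I]) (F i @^-1` [set f i])).
  by apply: fin_bigcap_measurable => // i _; exact: mF.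
apply/seteqP; split=> w /=; first by move=> <- i _; rewrite /= ffunE.
by move=> Fw; apply/ffunP => i; rewrite ffunE; exact: Fw.
Qed.

(** Values are peeled off a duplicate-free list, which reduces the claim to additivity for two
    disjoint sets. *)
Lemma fin_rv_law (A : finType) (F : Om -> A) (p : pred A) (E : set Om) :
  fin_rv F -> measurable E ->
  (P (E `&` [set w | p (F w)]) = \sum_(a | p a) P (E `&` [set w | F w = a]))%E.
Proof.
move=> mF mE.
have mem_law (s : seq A) : uniq s ->
    P (E `&` [set w | F w \in s]) = (\sum_(a <- s) P (E `&` [set w | F w = a]))%E.
  elim: s => [_|a s IH /= /andP[a_s us]].
    rewrite big_nil (_ : _ `&` _ = set0) ?measure0 //.
    by apply/seteqP; split=> w // [_ /=].
  rewrite big_cons -IH // -measureU.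
  - congr (P _); apply/seteqP; split=> w /=.
      by rewrite inE => -[? /orP[/eqP|]]; [left|right].
    by rewrite inE => -[[? ->]|[? ->]]; rewrite ?eqxx ?orbT.
  - apply: measurableI => //; exact: mF.
  - apply: measurableI => //; exact: (fin_rv_measurable (fun x => x \in s)).
  - by apply/seteqP; split=> w //= [[_ ->] [_]]; rewrite (negbTE a_s).
transitivity (\sum_(a <- enum p) P (E `&` [set w | F w = a]))%E; last by rewrite big_enum.
rewrite -mem_law ?enum_uniq //.
by congr (P (_ `&` _)); apply/seteqP; split=> w /=; rewrite mem_enum.
Qed.

Lemma fin_rv_total (A : finType) (F : Om -> A) (E : set Om) :
  fin_rv F -> measurable E -> (P E = \sum_a P (E `&` [set w | F w = a]))%E.
Proof.
move=> mF mE; rewrite -(fin_rv_law predT mF mE).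
by congr (P _); apply/seteqP; split=> w /=; [split | case].
Qed.

Definition law (A : finType) (F : Om -> A) (a : A) : R := fine (P [set w | F w = a]).

Lemma law_ge0 (A : finType) (F : Om -> A) a : 0 <= law F a.
Proof. exact: fine_ge0. Qed.

(** Turns an event expressed through [F] into a finite real sum, so that later arguments can
    manipulate sums instead of measures. *)
Lemma lawE (A : finType) (F : Om -> A) (p : pred A) (S : set Om) :
  fin_rv F -> (forall w, S w <-> p (F w)) -> P S = (\sum_(a | p a) law F a)%:E.
Proof.
move=> mF Sp; rewrite (_ : S = setT `&` [set w | p (F w)]).
  rewrite fin_rv_law // -sumEFin; apply: eq_bigr => a _.
  rewrite setTI fineK // fin_num_measure //; exact: mF.
by rewrite setTI; apply/seteqP; split=> w /Sp.
Qed.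

End FiniteLaw.

(** * Necessity in the models without a latent variable *)

(** The event [s] is a disjoint union of fibres of [r], and the product formula adds up over them.
    The models state independence atom by atom, while boxes need it for unions of atoms. *)
Lemma sum_indep_comp (R : realType) (J C : finType) (g : J -> R) (u : pred J) (r : J -> C)
    (s : pred C) :
  (forall c, \sum_(j | u j && (r j == c)) g j =
             (\sum_(j | u j) g j) * \sum_(j | r j == c) g j) ->
  \sum_(j | u j && s (r j)) g j = (\sum_(j | u j) g j) * \sum_(j | s (r j)) g j.
Proof.
move=> indep.
rewrite (partition_big r s) /=; last by move=> j /andP[].
rewrite [X in _ * X](partition_big r s) //= mulr_sumr; apply: eq_bigr => c sc.
rewrite (eq_bigl (fun j => u j && (r j == c))); last first.
  by move=> j; case: eqP => [->|]; rewrite ?sc ?andbT ?andbF.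
rewrite indep; congr (_ * _); apply: eq_bigl => j.
by case: eqP => [->|]; rewrite ?sc ?andbF.
Qed.

Section Necessity.
Local Open Scope classical_set_scope.
Context (R : realType) (M K Q : nat).
Context (d : measure_display) (Om : measurableType d) (P : probability Om R).
Context (Z : Om -> 'I_Q) (X : Om -> 'I_K).
Context (Ypo : 'I_K -> 'I_Q -> Om -> 'I_M) (Xpo : 'I_Q -> Om -> 'I_K).
Hypothesis mZ : fin_rv Z.
Hypothesis mX : fin_rv X.
Hypothesis mYpo : forall i z, fin_rv (Ypo i z).
Hypothesis mXpo : forall z, fin_rv (Xpo z).

(** Condition (b) multiplied by the probability of [Z = q], which avoids conditional probabilities;
    this is the common target for all models. *)
Definition box_bound : Prop := forall (q : 'I_Q) (V : 'I_K -> {set 'I_M}),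
  (P [set w | forall i, Yx Z Ypo i w \in V i] * P [set w | Z w = q] <=
   P [set w | Z w = q /\ Yobs Z X Ypo w \in V (X w)])%E.

(** All random elements are gathered into one variable [G] with finite range [J], so that every
    event becomes a sum of the weights [g] over a subset of [J]. *)
Let Yall (w : Om) : {ffun 'I_K * 'I_Q -> 'I_M} := [ffun iz => Ypo iz.1 iz.2 w].
Let Xall (w : Om) : {ffun 'I_Q -> 'I_K} := [ffun z => Xpo z w].
Let J := ('I_Q * 'I_K * ({ffun 'I_K * 'I_Q -> 'I_M} * {ffun 'I_Q -> 'I_K}))%type.
Let G (w : Om) : J := ((Z w, X w), (Yall w, Xall w)).

Let mG : fin_rv G.
Proof.
apply: fin_rv_pair; first exact: fin_rv_pair.
by apply: fin_rv_pair; apply: fin_rv_ffun => //= -[i z]; exact: mYpo.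
Qed.

Let zj (j : J) : 'I_Q := j.1.1.
Let xj (j : J) : 'I_K := j.1.2.
Let yj (j : J) (i : 'I_K) (z : 'I_Q) : 'I_M := j.2.1 (i, z).
Let g : J -> R := law P G.
Let g_ge0 j : 0 <= g j. Proof. exact: law_ge0. Qed.

Let GyE w i z : yj (G w) i z = Ypo i z w.
Proof. by rewrite /yj ffunE. Qed.

Let YallP w (y : {ffun 'I_K * 'I_Q -> 'I_M}) :
  reflect (forall i z, Ypo i z w = y (i, z)) (Yall w == y).
Proof.
apply: (iffP eqP) => [<- i z|Yy]; first by rewrite ffunE.
by apply/ffunP => -[i z]; rewrite ffunE.
Qed.

Let XallP w (b : {ffun 'I_Q -> 'I_K}) :
  reflect (forall z, Xpo z w = b z) (Xall w == b).
Proof.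
apply: (iffP eqP) => [<- z|Xb]; first by rewrite ffunE.
by apply/ffunP => z; rewrite ffunE.
Qed.

Let P_Z q : P [set w | Z w = q] = (\sum_(j | zj j == q) g j)%:E.
Proof. by apply: lawE => // w; split=> /eqP. Qed.

Let P_box (V : 'I_K -> {set 'I_M}) :
  P [set w | forall i, Yx Z Ypo i w \in V i] =
  (\sum_(j | [forall i, yj j i (zj j) \in V i]) g j)%:E.
Proof.
apply: lawE => // w; split=> [YV|/forallP YV i].
  by apply/forallP => i; rewrite GyE; exact: YV.
by have := YV i; rewrite GyE.
Qed.

Let P_obs (q : 'I_Q) (V : 'I_K -> {set 'I_M}) :
  P [set w | Z w = q /\ Yobs Z X Ypo w \in V (X w)] =
  (\sum_(j | (zj j == q) && (yj j (xj j) q \in V (xj j))) g j)%:E.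
Proof.
apply: lawE => // w; rewrite GyE; split=> [[<- YV]|/andP[/eqP <- YV]] //.
by rewrite eqxx.
Qed.

(** Grouping the atoms by the vector of [Yx], respectively by treatment and observed outcome,
    recovers the two sides; the positive probability of [Z = q] then cancels. *)
Lemma ineqs_of_box_bound (Pm : {ffun 'I_K -> 'I_M} -> R) (Pc : 'I_Q -> 'I_K -> 'I_M -> R) :
  (forall q : 'I_Q, (0 < P [set w | Z w = q])%E) ->
  (forall a : {ffun 'I_K -> 'I_M},
      P [set w | forall i, Yx Z Ypo i w = a i] = (Pm a)%:E) ->
  (forall (q : 'I_Q) (k : 'I_K) (m : 'I_M),
      P [set w | Z w = q /\ X w = k /\ Yobs Z X Ypo w = m]
      = ((Pc q k m)%:E * P [set w | Z w = q])%E) ->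
  box_bound -> ineqs_hold Pm Pc.
Proof.
move=> P_Z_gt0 margP condP bound q V _ _.
have sumPm : \sum_(a : {ffun 'I_K -> 'I_M} | [forall k, a k \in V k]) Pm a =
    \sum_(j | [forall i, yj j i (zj j) \in V i]) g j.
  rewrite [RHS](partition_big (fun j => [ffun i => yj j i (zj j)])
    (fun a : {ffun 'I_K -> 'I_M} => [forall k, a k \in V k])) /=; last first.
    by move=> j /forallP jV; apply/forallP => k; rewrite ffunE.
  apply: eq_bigr => a aV; apply: EFin_inj; rewrite -margP.
  apply: lawE => // w; split=> [Ya|/andP[_ /eqP <-] i]; last by rewrite ffunE GyE.
  have -> : [ffun i => yj (G w) i (zj (G w))] = a.
    by apply/ffunP => i; rewrite ffunE GyE; exact: Ya.
  rewrite eqxx andbT; apply/forallP => i; rewrite GyE.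
  by have /forallP /(_ i) := aV; rewrite -Ya.
have sumPc : (\sum_(k < K) \sum_(m in V k) Pc q k m) * \sum_(j | zj j == q) g j =
    \sum_(j | (zj j == q) && (yj j (xj j) q \in V (xj j))) g j.
  rewrite [RHS](partition_big xj predT) //= mulr_suml; apply: eq_bigr => k _.
  rewrite [RHS](partition_big (fun j => yj j (xj j) q) (mem (V k))) /=; last first.
    by move=> j /andP[/andP[_ ?] /eqP <-].
  rewrite mulr_suml; apply: eq_bigr => m mV; apply: EFin_inj.
  rewrite EFinM -P_Z -condP; apply: lawE => // w; rewrite GyE.
  split=> [[<- [Xk Ym]]|/andP[/andP[/andP[/eqP <- _] /eqP <-] /eqP <-]] //.
  have -> : Ypo (xj (G w)) (Z w) w = m by [].
  by rewrite /zj /xj /= Xk mV !eqxx.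
have := bound q V; rewrite P_box P_Z P_obs -EFinM lee_fin -sumPm -sumPc.
by rewrite ler_pM2r // -lte_fin -P_Z.
Qed.

(** Outcome events are unions of atoms of the pair of outcome and treatment vectors, so
    [sum_indep_comp] applies. *)
Lemma indep_I1_I2 : indep_I1 P Z Ypo Xpo -> indep_I2 P Z Ypo.
Proof.
move=> I1 q a.
have indep (s : pred ({ffun 'I_K * 'I_Q -> 'I_M} * {ffun 'I_Q -> 'I_K})) :
    \sum_(j : J | (zj j == q) && s j.2) g j =
    (\sum_(j | zj j == q) g j) * \sum_(j : J | s j.2) g j.
  apply: (@sum_indep_comp _ _ _ g (fun j => zj j == q) snd) => -[y b].
  apply: EFin_inj; rewrite EFinM -P_Z; move: (I1 q y b).
  rewrite (@lawE _ _ _ P _ G (fun j => (zj j == q) && (j.2 == (y, b)))) //; last first.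
    move=> w; rewrite xpair_eqE; split=> [[Zq [/YallP Yy /XallP Xb]]|].
      by apply/and3P; split=> //; apply/eqP.
    by move=> /and3P[/eqP Zq /YallP Yy /XallP Xb].
  move=> ->; congr (_ * _)%E; apply: lawE => // w; rewrite xpair_eqE.
  by split=> [[/YallP -> /XallP ->]|/andP[/YallP ? /XallP ?]].
rewrite P_Z (@lawE _ _ _ P _ G (fun j => (zj j == q) && (j.2.1 == a))) //; last first.
  by move=> w; split=> [[/eqP ? /YallP ?]|/andP[/eqP ? /YallP ?]] //; apply/andP.
rewrite (indep (fun yb => yb.1 == a)) EFinM; congr (_ * _)%E; apply/esym; apply: lawE => // w.
by split=> /YallP.
Qed.

(** An almost sure identity holds at every atom of nonzero weight. *)
Let E1_support : excl_E1 P Ypo ->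
  forall j i z z', g j != 0 -> yj j i z = yj j i z'.
Proof.
move=> E1 j i z z' gj; apply/eqP; apply: contraNT gj => neq_y.
have := E1 i z z'.
rewrite (@lawE _ _ _ P _ G (fun j => yj j i z != yj j i z')) //; last first.
  by move=> w; rewrite !GyE; split=> /eqP.
by case=> /eqP; rewrite psumr_eq0 // => /allP /(_ j (mem_index_enum _)); rewrite neq_y.
Qed.

Lemma excl_E1_E2 : excl_E1 P Ypo -> excl_E2 P Ypo.
Proof.
move=> /E1_support E1 z z' a.
have evE z0 : P [set w | forall i, Ypo i z0 w = a i] =
    (\sum_(j | [forall i, yj j i z0 == a i]) g j)%:E.
  apply: lawE => // w; split=> [Ya|/forallP Ya i].
    by apply/forallP => i; rewrite GyE Ya.
  by have /eqP := Ya i; rewrite GyE.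
rewrite !evE; congr (_%:E); rewrite big_mkcond [RHS]big_mkcond; apply: eq_bigr => j _.
have [->|gj] := eqVneq (g j) 0; first by rewrite !if_same.
by congr (if _ then _ else _); apply: eq_forallb => i; rewrite (E1 j i z z').
Qed.

(** By I2 the box event for the outcomes at [z] is independent of [Z = z], and by E2 its probability
    does not depend on [z]. Averaging over [z] shows that the box for [Yx] is as likely as the box
    at [q]. *)
Lemma box_bound_Mod3 : excl_E2 P Ypo -> indep_I2 P Z Ypo -> box_bound.
Proof.
move=> E2 I2 q V.
pose inV z (j : J) := [forall i, yj j i z \in V i].
have indep z : \sum_(j | (zj j == z) && inV z j) g j =
    (\sum_(j | zj j == z) g j) * \sum_(j | inV z j) g j.
  apply: (@sum_indep_comp _ _ _ g (fun j => zj j == z) (fun j : J => j.2.1)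
    (fun y => [forall i, y (i, z) \in V i])) => a.
  apply: EFin_inj; rewrite EFinM -P_Z; move: (I2 z a).
  rewrite (@lawE _ _ _ P _ G (fun j => (zj j == z) && (j.2.1 == a))) //; last first.
    by move=> w; split=> [[/eqP ? /YallP ?]|/andP[/eqP ? /YallP ?]] //; apply/andP.
  by move=> ->; congr (_ * _)%E; apply: lawE => // w; split=> /YallP.
have eq_inV z : \sum_(j | inV z j) g j = \sum_(j | inV q j) g j.
  have part z0 : \sum_(j | inV z0 j) g j =
      \sum_(a : {ffun 'I_K -> 'I_M} | [forall k, a k \in V k])
        \sum_(j | [ffun i => yj j i z0] == a) g j.
    rewrite (partition_big (fun j => [ffun i => yj j i z0])
      (fun a : {ffun 'I_K -> 'I_M} => [forall k, a k \in V k])) /=; last first.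
      by move=> j /forallP jV; apply/forallP => k; rewrite ffunE.
    apply: eq_bigr => a aV; apply: eq_bigl => j; case: eqP => [ja|]; rewrite ?andbF // andbT.
    by apply/forallP => i; have /forallP /(_ i) := aV; rewrite -ja ffunE.
  rewrite !part; apply: eq_bigr => a _; apply: EFin_inj.
  have evE z0 : P [set w | forall i, Ypo i z0 w = a i] =
      (\sum_(j | [ffun i => yj j i z0] == a) g j)%:E.
    apply: lawE => // w; split=> [Ya|/eqP <- i]; last by rewrite ffunE GyE.
    by apply/eqP/ffunP => i; rewrite ffunE GyE.
  by rewrite -!evE; exact: E2.
have total : \sum_z \sum_(j | zj j == z) g j = 1.
  rewrite -(partition_big zj predT (P := predT)) //.
  by apply: EFin_inj; rewrite -(probability_setT P); apply/esym; apply: lawE.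
have boxE : \sum_(j | [forall i, yj j i (zj j) \in V i]) g j = \sum_(j | inV q j) g j.
  rewrite (partition_big zj predT) //=.
  transitivity (\sum_z (\sum_(j | zj j == z) g j) * \sum_(j | inV q j) g j).
    apply: eq_bigr => z _; rewrite -(eq_inV z) -indep; apply: eq_bigl => j.
    by rewrite andbC; case: eqP => // <-.
  by rewrite -mulr_suml total mul1r.
(* The product is now the probability of the box at [q] together with [Z = q], an event on which the
   observed outcome lies in [V X]. *)
rewrite P_box P_Z P_obs -EFinM lee_fin boxE mulrC -indep.
rewrite big_mkcond [leRHS]big_mkcond; apply: ler_sum => j _ /=.
case: eqP => //= _; case: ifP => [/forallP /(_ (xj j)) ->//|_].
by case: ifP.
Qed.

(** I3 makes [Z] independent of one pair [(X(q), Y(x_k, q))] at a time. The box is therefore split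
    by the value [k] of [X(q)], and on each piece only the constraint on coordinate [k] is kept
    before independence is used. *)
Lemma box_bound_Mod4 :
  consistency_X Z X Xpo -> excl_E1 P Ypo -> indep_I3 P Z Ypo Xpo -> box_bound.
Proof.
move=> consX /E1_support E1 I3 q V.
pose bj (j : J) : 'I_K := j.2.2 q.
have boxE : \sum_(j | [forall i, yj j i (zj j) \in V i]) g j =
    \sum_(j | [forall i, yj j i q \in V i]) g j.
  rewrite big_mkcond [RHS]big_mkcond; apply: eq_bigr => j _.
  have [->|gj] := eqVneq (g j) 0; first by rewrite !if_same.
  by congr (if _ then _ else _); apply: eq_forallb => i; rewrite (E1 j i (zj j) q).
have indep k : \sum_(j | (zj j == q) && ((bj j == k) && (yj j k q \in V k))) g j =
    (\sum_(j | zj j == q) g j) * \sum_(j | (bj j == k) && (yj j k q \in V k)) g j.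
  apply: (@sum_indep_comp _ _ _ g (fun j => zj j == q) (fun j => (bj j, yj j k q))
    (fun c => (c.1 == k) && (c.2 \in V k))) => -[b m].
  apply: EFin_inj; rewrite EFinM -P_Z; move: (I3 q k q b m).
  rewrite (@lawE _ _ _ P _ G (fun j => (zj j == q) && ((bj j, yj j k q) == (b, m)))) //.
    move=> ->; congr (_ * _)%E; apply: lawE => // w; rewrite GyE /bj ffunE.
    by rewrite xpair_eqE; split=> [[/eqP -> /eqP ->]|/andP[/eqP ? /eqP ?]].
  move=> w; rewrite GyE /bj ffunE xpair_eqE.
  split=> [[/eqP ? [/eqP ? /eqP ?]]|/and3P[/eqP ? /eqP ? /eqP ?]] //.
  exact/and3P.
have obsE : P [set w | Z w = q /\ Yobs Z X Ypo w \in V (X w)] =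
    (\sum_(j | (zj j == q) && (yj j (bj j) q \in V (bj j))) g j)%:E.
  apply: lawE => // w; rewrite GyE /bj ffunE /Yobs; split=> [[Zq]|/andP[/eqP Zq]].
    by rewrite consX Zq => ->; rewrite andbT; apply/eqP.
  by rewrite /= consX (_ : Z w = q).
rewrite P_box P_Z obsE -EFinM lee_fin boxE mulrC.
rewrite [leRHS](partition_big bj predT) //=.
rewrite (eq_bigr (fun k => (\sum_(j | zj j == q) g j) *
    \sum_(j | (bj j == k) && (yj j k q \in V k)) g j)); last first.
  move=> k _; rewrite -indep; apply: eq_bigl => j; rewrite -andbA; congr (_ && _).
  by rewrite andbC; case: eqP => // ->.
rewrite -mulr_sumr ler_wpM2l ?sumr_ge0 //.
rewrite (partition_big bj predT) //=; apply: ler_sum => k _.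
rewrite big_mkcond [leRHS]big_mkcond; apply: ler_sum => j _ /=.
rewrite andbC; case: eqP => //= _; case: ifP => [/forallP /(_ k) ->//|_].
by case: ifP.
Qed.

End Necessity.

(** * Almost everywhere equality and sums under the integral *)

Section NonnegIntegrals.
Local Open Scope classical_set_scope.
Context (R : realType) (d : measure_display) (T : measurableType d).
Context (mu : probability T R).
Implicit Types (f g : T -> R) (A : set T).

Lemma measurable_EFin_on f A : measurable_fun setT f -> measurable_fun A (EFin \o f).
Proof.
by move=> mf; apply: (measurable_funS measurableT (@subsetT _ A)); exact: measurableT_comp.
Qed.

(** Used to identify two versions of one conditional probability; the bounds make [f] integrable
    under the finite measure [mu]. *)
Lemma ae_eq_of_integrals f g :
  measurable_fun setT f -> measurable_fun setT g -> (forall t, 0 <= f t <= 1) ->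
  (forall A, measurable A ->
    \int[mu]_(t in A) (f t)%:E = \int[mu]_(t in A) (g t)%:E)%E ->
  {ae mu, forall t, f t = g t}.
Proof.
move=> mf mg f01 eq_int.
have int_f : mu.-integrable setT (EFin \o f).
  apply: (le_integrable measurableT _ _ (finite_measure_integrable_cst mu 1 measurableT)).
    exact: measurable_EFin_on.
  by move=> t _ /=; case/andP: (f01 t) => ? ?; rewrite lee_fin ger0_norm // normr1.
have : ae_eq mu setT (EFin \o f) (EFin \o g).
  apply: integral_ae_eq => //; first exact: measurable_EFin_on.
  by move=> A _; exact: eq_int.
by apply: filterS => t /= /(_ I) [].
Qed.

Lemma integral_ae f g A :
  measurable_fun setT f -> measurable_fun setT g -> measurable A ->
  {ae mu, forall t, f t = g t} ->
  (\int[mu]_(t in A) (f t)%:E = \int[mu]_(t in A) (g t)%:E)%E.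
Proof.
move=> mf mg mA fg; apply: ae_eq_integral => //; [exact: measurable_EFin_on..|].
by apply: filterS fg => t -> _.
Qed.

Lemma integral_sum (I : finType) (p : pred I) (f : I -> T -> R) A :
  measurable A -> (forall i, measurable_fun setT (f i)) -> (forall i t, 0 <= f i t) ->
  (\int[mu]_(t in A) (\sum_(i | p i) f i t)%R%:E =
   \sum_(i | p i) \int[mu]_(t in A) (f i t)%:E)%E.
Proof.
move=> mA mf f0; rewrite -big_filter -ge0_integral_sum //.
- by apply: eq_integral => t _; rewrite -sumEFin big_filter.
- by move=> i; exact: measurable_EFin_on.
- by move=> i t _; rewrite lee_fin.
Qed.

Lemma measurable_fun_sum_cond (I : finType) (p : pred I) (f : I -> T -> R) :
  (forall i, measurable_fun setT (f i)) ->
  measurable_fun setT (fun t => \sum_(i | p i) f i t).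
Proof.
move=> mf; under eq_fun do rewrite -big_filter.
exact: measurable_sum.
Qed.

End NonnegIntegrals.

(** * Necessity in the latent-variable model *)

Section LatentNecessity.
Local Open Scope classical_set_scope.
Context (R : realType) (M K Q : nat) (k0 : 'I_K).
Context (d : measure_display) (Om : measurableType d) (P : probability Om R).
Context (Z : Om -> 'I_Q) (X : Om -> 'I_K) (Ypo : 'I_K -> 'I_Q -> Om -> 'I_M).
Hypothesis mZ : fin_rv Z.
Hypothesis mX : fin_rv X.
Hypothesis mYpo : forall i z, fin_rv (Ypo i z).
Context (dT : measure_display) (T : measurableType dT) (U : Om -> T).
Hypothesis mU : measurable_fun setT U.
Hypothesis E3 : excl_E3 P Ypo U.
Hypothesis I4 : indep_I4 P Z X Ypo U.

(** [U] is bundled as a measurable function to form its law [mu], against which all versions are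
    integrated on [T]. *)
Let mUP : isMeasurableFun d dT Om T U := isMeasurableFun.Build d dT Om T U mU.
Let Upack : {mfun Om >-> T} := HB.pack U mUP.
Let mu : probability T R := distribution P Upack.

Let cprob_integral (E : set Om) (f : T -> R) (A : set T) :
  cprob_version P U E f -> measurable A ->
  P (E `&` U @^-1` A) = (\int[mu]_(t in A) (f t)%:E)%E.
Proof.
move=> [mf [f01 fE]] mA; rewrite fE //; apply/esym.
apply: (@ge0_integral_pushforward _ _ _ _ _ U mU P A (EFin \o f)) => //.
  exact: measurable_EFin_on.
by move=> t _ /=; rewrite lee_fin; case/andP: (f01 t).
Qed.

Let cprob_ae (E : set Om) (f g : T -> R) :
  cprob_version P U E f -> cprob_version P U E g -> {ae mu, forall t, f t = g t}.
Proof.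
move=> fE gE; apply: ae_eq_of_integrals; [by case: fE | by case: gE | by case: fE => _ [] |].
by move=> A mA; rewrite -(cprob_integral fE mA) (cprob_integral gE mA).
Qed.

Let outcome_version (q : 'I_Q) : exists h : 'I_K -> 'I_M -> T -> R,
  forall k m, cprob_version P U [set w | Ypo k q w = m] (h k m).
Proof.
have /choice [h hP] (km : 'I_K * 'I_M) :
    exists f, cprob_version P U [set w | Ypo km.1 q w = km.2] f.
  by have [f [fE _]] := E3 km.1 q q km.2; exists f.
by exists (fun k m => h (k, m)) => k m; exact: (hP (k, m)).
Qed.

Let treatment_version : exists g : 'I_K -> 'I_Q -> T -> R,
  forall k z, cprob_version P U [set w | (X w, Z w) = (k, z)] (g k z).
Proof.
have /choice [g gP] (kz : 'I_K * 'I_Q) :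
    exists f, cprob_version P U [set w | (X w, Z w) = (kz.1, kz.2)] f.
  (* A version for [(X, Z)] is read off from I4, instantiated at an arbitrary outcome value. *)
  by have [_ [g [_ gE _]]] := I4.2 kz.1 kz.2 (Ypo kz.1 kz.2 point) (kz.1, kz.2); exists g.
by exists (fun k z => g (k, z)) => k z; exact: (gP (k, z)).
Qed.

Let preimage_measurable (A : set T) : measurable A -> measurable (U @^-1` A).
Proof. by move=> mA; rewrite -[_ @^-1` _]setTI; exact: mU. Qed.

Let mYx (j : 'I_K) : fin_rv (Yx Z Ypo j).
Proof.
move=> m; pose F w := (Z w, [ffun z => Ypo j z w]).
have mF : fin_rv F by apply: fin_rv_pair => //; apply: fin_rv_ffun.
pose p (zy : 'I_Q * {ffun 'I_Q -> 'I_M}) := zy.2 zy.1 == m.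
rewrite (_ : _ @^-1` _ = [set w | p (F w)]); first exact: fin_rv_measurable.
by apply/seteqP; split=> w /=; rewrite /p ffunE => /eqP.
Qed.

Let box_measurable (V : 'I_K -> {set 'I_M}) :
  measurable [set w | forall i, Yx Z Ypo i w \in V i].
Proof.
pose F w := [ffun k => Yx Z Ypo k w].
have mF : fin_rv F by apply: fin_rv_ffun.
pose p (a : {ffun 'I_K -> 'I_M}) := [forall k, a k \in V k].
rewrite (_ : [set _ | _] = [set w | p (F w)]); first exact: fin_rv_measurable.
apply/seteqP; split=> w /=; first by move=> YV; apply/forallP => k; rewrite ffunE.
by move=> /forallP YV k; have := YV k; rewrite ffunE.
Qed.

Let mYobs : fin_rv (Yobs Z X Ypo).
Proof.
move=> m; pose F w := (X w, [ffun k => Yx Z Ypo k w]).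
have mF : fin_rv F by apply: fin_rv_pair => //; apply: fin_rv_ffun.
pose p (xy : 'I_K * {ffun 'I_K -> 'I_M}) := xy.2 xy.1 == m.
rewrite (_ : _ @^-1` _ = [set w | p (F w)]); first exact: (@fin_rv_measurable _ _ _ F p).
by apply/seteqP; split=> w /=; rewrite /p ffunE => /eqP.
Qed.

Section Versions.
Context (q : 'I_Q) (h : 'I_K -> 'I_M -> T -> R) (g : 'I_K -> 'I_Q -> T -> R).
Hypothesis hP : forall k m, cprob_version P U [set w | Ypo k q w = m] (h k m).
Hypothesis gP : forall k z, cprob_version P U [set w | (X w, Z w) = (k, z)] (g k z).

Let mh k m : measurable_fun setT (h k m). Proof. by case: (hP k m). Qed.
Let mg k z : measurable_fun setT (g k z). Proof. by case: (gP k z). Qed.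
Let h_ge0 k m t : 0 <= h k m t.
Proof. by case: (hP k m) => _ [/(_ t) /andP[]]. Qed.
Let g_ge0 k z t : 0 <= g k z t.
Proof. by case: (gP k z) => _ [/(_ t) /andP[]]. Qed.

(** I4 gives a product of versions, and E3 replaces the version at [z] by the one at [q]: a single
    [h] serves every instrument value. *)
Let joint_integral (j k : 'I_K) (z z' : 'I_Q) (m : 'I_M) (A : set T) :
  measurable A ->
  P ([set w | Ypo j z w = m /\ (X w, Z w) = (k, z')] `&` U @^-1` A) =
  (\int[mu]_(t in A) (h j m t * g k z' t)%:E)%E.
Proof.
move=> mA; have [f [f' [fE f'E ff'E]]] := I4.2 j z m (k, z').
have [f0 [f0q f0z]] := E3 j q z m.
rewrite (cprob_integral ff'E mA); apply: integral_ae => //.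
- by case: ff'E.
- exact: measurable_funM.
apply: filterS3 (cprob_ae fE f0z) (cprob_ae f0q (hP j m)) (cprob_ae f'E (gP k z')).
by move=> t -> -> ->.
Qed.

Let zeta z : R := fine (P [set w | Z w = z]).

Let zetaE z : P [set w | Z w = z] = (zeta z)%:E.
Proof. by rewrite /zeta fineK // fin_num_measure //; exact: mZ. Qed.

Let zeta_ge0 z : 0 <= zeta z. Proof. exact: fine_ge0. Qed.

(** Both sides are versions of the probability of [Z = z] given [U]; the left one is constant
    because [U] and [Z] are independent. *)
Let sum_g_ae z : {ae mu, forall t, zeta z = \sum_k g k z t}.
Proof.
apply: ae_eq_of_integrals => //.
- exact: measurable_fun_sum_cond.
- by move=> _; rewrite zeta_ge0 -lee_fin -zetaE probability_le1 //; exact: mZ.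
move=> A mA; rewrite integral_sum //.
have -> : (\int[mu]_(_ in A) (zeta z)%:E = P (U @^-1` A) * P [set w | Z w = z])%E.
  by rewrite integral_cst // -zetaE muleC.
rewrite -I4.1 //.
under eq_bigr do rewrite -(cprob_integral (gP _ z) mA).
rewrite setIC (fin_rv_total P mX); last first.
  by apply: measurableI; [exact: mZ | exact: preimage_measurable].
apply: eq_bigr => k _; congr (P _); apply/seteqP; split=> w /=.
  by move=> [[-> ?] ->].
by move=> [[-> ->] ?].
Qed.

Let integral_mul_sum_g z (f : T -> R) (A : set T) :
  measurable A -> measurable_fun setT f -> (forall t, 0 <= f t) ->
  ((zeta z)%:E * \int[mu]_(t in A) (f t)%:E =
   \sum_k \int[mu]_(t in A) (f t * g k z t)%:E)%E.
Proof.
move=> mA mf f0; rewrite -ge0_integralZl_EFin //; last first.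
- exact: measurable_EFin_on.
- by move=> t _; rewrite lee_fin.
rewrite -integral_sum //; last first.
- by move=> k t; exact: mulr_ge0.
- by move=> k; exact: measurable_funM.
under eq_integral do rewrite -EFinM.
apply: integral_ae => //.
- exact: measurable_funM.
- by apply: measurable_fun_sum_cond => k; exact: measurable_funM.
apply: filterS (sum_g_ae z) => t ->; rewrite mulrC mulr_sumr //.
Qed.

(** On [Z = z] the outcome is [Ypo j z]. Summing [joint_integral] over treatments leaves [h j m]
    times the probability of [Z = z] given [U], which is constant. *)
Let outcome_instrument (j : 'I_K) (z : 'I_Q) (m : 'I_M) (A : set T) : measurable A ->
  P (U @^-1` A `&` [set w | (Z w, Yx Z Ypo j w) = (z, m)]) =
  ((zeta z)%:E * \int[mu]_(t in A) (h j m t)%:E)%E.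
Proof.
move=> mA; rewrite integral_mul_sum_g //.
under eq_bigr do rewrite -(joint_integral _ _ z) //.
rewrite (fin_rv_total P mX); last first.
  apply: measurableI; first exact: preimage_measurable.
  by apply: fin_rv_pair; [exact: mZ | exact: mYx].
apply: eq_bigr => k _; congr (P _); apply/seteqP; split=> w /=; rewrite /Yx.
  by move=> [[? [Zz Ym]] ->]; rewrite -Ym Zz.
by move=> [[Ym [-> Zz]] ?]; rewrite Zz Ym.
Qed.

Let box_slab (V : 'I_K -> {set 'I_M}) (j : 'I_K) (A : set T) : measurable A ->
  P (U @^-1` A `&` [set w | Yx Z Ypo j w \in V j]) =
  (\int[mu]_(t in A) (\sum_(m in V j) h j m t)%:E)%E.
Proof.
move=> mA.
transitivity (P (U @^-1` A `&`
    [set w | (fun zm => zm.2 \in V j) (Z w, Yx Z Ypo j w)])) => //.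
rewrite (@fin_rv_law _ _ _ P _ (fun w => (Z w, Yx Z Ypo j w))
  (fun zm => zm.2 \in V j)); last 2 first.
- by apply: fin_rv_pair; [exact: mZ | exact: mYx].
- exact: preimage_measurable.
rewrite integral_sum //.
rewrite (eq_bigr (fun zm => (zeta zm.1)%:E * \int[mu]_(t in A) (h j zm.2 t)%:E)%E); last first.
  by move=> [z m] _; exact: outcome_instrument.
rewrite -(pair_big predT (mem (V j))
  (fun z m => (zeta z)%:E * \int[mu]_(t in A) (h j m t)%:E)%E) /= exchange_big /=.
apply: eq_bigr => m _; rewrite -ge0_sume_distrl; last by move=> z _; rewrite lee_fin.
rewrite (_ : \sum_z (zeta z)%:E = 1)%E ?mul1e //.
rewrite -(probability_setT P) (fin_rv_total P mZ measurableT).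
by apply: eq_bigr => z _; rewrite setTI zetaE.
Qed.

Let obs_cell (V : 'I_K -> {set 'I_M}) (A : set T) : measurable A ->
  P (U @^-1` A `&` [set w | Z w = q /\ Yobs Z X Ypo w \in V (X w)]) =
  (\sum_k \int[mu]_(t in A) ((\sum_(m in V k) h k m t) * g k q t)%:E)%E.
Proof.
move=> mA.
transitivity (P ((U @^-1` A `&` [set w | Z w = q]) `&`
    [set w | (fun km => km.2 \in V km.1) (X w, Yobs Z X Ypo w)])).
  by congr (P _); apply/seteqP; split=> w /= [] => [? []|[]].
rewrite (@fin_rv_law _ _ _ P _ (fun w => (X w, Yobs Z X Ypo w))
  (fun km => km.2 \in V km.1)); last 2 first.
- by apply: fin_rv_pair; [exact: mX | exact: mYobs].
- by apply: measurableI; [exact: preimage_measurable | exact: mZ].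
rewrite (eq_bigr (fun km => \int[mu]_(t in A) (h km.1 km.2 t * g km.1 q t)%:E)%E); last first.
  move=> [k m] _; rewrite -(joint_integral _ _ q) //.
  congr (P _); apply/seteqP; split=> w /=; rewrite /Yobs.
    by move=> [[? Zq] [Xk Ym]]; rewrite -Ym Xk Zq.
  by move=> [[Ym [Xk Zq]] ?]; rewrite Xk Zq Ym.
rewrite -(pair_big_dep predT (fun k m => m \in V k)
  (fun k m => \int[mu]_(t in A) (h k m t * g k q t)%:E)%E) /=.
apply: eq_bigr => k _; rewrite -integral_sum //.
- by apply: eq_integral => t _; rewrite mulr_suml.
- by move=> m; exact: measurable_funM.
- by move=> m t; exact: mulr_ge0.
Qed.

(** The box lies in its slab at [j]. Over [A], the factor [zeta q] splits into the [g k q], and in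
    the [k]-th term the minimal sum for [j] is bounded by the sum for [k], which yields the observed
    probability. *)
Let box_bound_on (V : 'I_K -> {set 'I_M}) (j : 'I_K) (A : set T) : measurable A ->
  (forall t k, A t -> \sum_(m in V j) h j m t <= \sum_(m in V k) h k m t) ->
  (P (U @^-1` A `&` [set w | forall i, Yx Z Ypo i w \in V i]) * P [set w | Z w = q] <=
   P (U @^-1` A `&` [set w | Z w = q /\ Yobs Z X Ypo w \in V (X w)]))%E.
Proof.
move=> mA minj.
have mp k : measurable_fun setT (fun t => \sum_(m in V k) h k m t).
  exact: measurable_fun_sum_cond.
have p_ge0 k t : 0 <= \sum_(m in V k) h k m t by exact: sumr_ge0.
apply: (@le_trans _ _
  (P (U @^-1` A `&` [set w | Yx Z Ypo j w \in V j]) * P [set w | Z w = q])%E).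
  apply: lee_wpmul2r => //; apply: le_measure.
  - rewrite inE; apply: measurableI; first exact: preimage_measurable.
    exact: box_measurable.
  - rewrite inE; apply: measurableI; first exact: preimage_measurable.
    exact: (@fin_rv_measurable _ _ _ (Yx Z Ypo j) (mem (V j))).
  - by move=> w [? YV]; split=> //; exact: YV.
rewrite box_slab // obs_cell // zetaE muleC integral_mul_sum_g //.
apply: lee_sum => k _; apply: ge0_le_integral => //.
- by move=> t _; rewrite lee_fin mulr_ge0.
- by apply: measurable_EFin_on; exact: measurable_funM.
- by apply: measurable_EFin_on; exact: measurable_funM.
- by move=> t At; rewrite lee_fin ler_wpM2r // minj.
Qed.

Lemma box_bound_versions (V : 'I_K -> {set 'I_M}) :
  (P [set w | forall i, Yx Z Ypo i w \in V i] * P [set w | Z w = q] <=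
   P [set w | Z w = q /\ Yobs Z X Ypo w \in V (X w)])%E.
Proof.
pose p k t : R := \sum_(m in V k) h k m t.
have mp k : measurable_fun setT (p k) by exact: measurable_fun_sum_cond.
(* [C] records the order of the [p k t], so a single [p j] is minimal on each cell of [C]. *)
pose C t : {ffun 'I_K * 'I_K -> bool} := [ffun kk => p kk.1 t <= p kk.2 t].
have mC : fin_rv C.
  apply: fin_rv_ffun => -[k k'] b /=.
  have mle : measurable [set t | p k t <= p k' t].
    by rewrite -[X in measurable X]setTI; exact: measurable_fun_le.
  case: b; first exact: mle.
  rewrite (_ : _ @^-1` _ = ~` [set t | p k t <= p k' t]); first exact: measurableC.
  by apply/seteqP; split=> t /=; [move=> ->|move/negP/negbTE].
have cell_measurable c : measurable [set t | C t = c] by exact: mC.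
have split_cells (S : set Om) : measurable S ->
    (P S = \sum_c P (U @^-1` [set t | C t = c] `&` S))%E.
  move=> mS; rewrite (@fin_rv_total _ _ _ P _ (C \o U)) //.
    by apply: eq_bigr => c _; rewrite setIC.
  by move=> c; exact: (preimage_measurable (cell_measurable c)).
rewrite (split_cells [set w | forall i, Yx Z Ypo i w \in V i]) //.
rewrite (split_cells [set w | Z w = q /\ Yobs Z X Ypo w \in V (X w)]); last first.
  pose F w := (Z w, (X w, Yobs Z X Ypo w)).
  have mF : fin_rv F by apply: fin_rv_pair => //; apply: fin_rv_pair.
  pose r (zxy : 'I_Q * ('I_K * 'I_M)) := (zxy.1 == q) && (zxy.2.2 \in V zxy.2.1).
  rewrite (_ : [set _ | _] = [set w | r (F w)]); first exact: fin_rv_measurable.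
  by rewrite /r; apply/seteqP; split=> [w [/eqP /= -> ->]|w /andP[/eqP]].
rewrite ge0_sume_distrl; last by move=> c _; exact: measure_ge0.
apply: lee_sum => c _.
have [[t0 /= Ct0]|noC] := pselect ([set t | C t = c] !=set0).
  (* The minimiser at a single point [t0] of the cell; since [C] is constant there, it is minimal on
     the whole cell. *)
  pose j := [arg min_(i < k0) p i t0]%O.
  have jmin k : p j t0 <= p k t0.
    by rewrite /j; case: arg_minP => // i _; apply.
  apply: (@box_bound_on V j) => // t k /= Ct.
  have : C t (j, k) = C t0 (j, k) by rewrite Ct Ct0.
  by rewrite !ffunE /= jmin => ->.
rewrite (_ : [set t | C t = c] = set0); last first.
  by apply/seteqP; split=> t // Ct; apply: noC; exists t.
by rewrite preimage_set0 !set0I measure0 mul0e.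
Qed.

End Versions.

Lemma box_bound_Mod5 : box_bound P Z X Ypo.
Proof.
move=> q V; have [h hP] := outcome_version q; have [g gP] := treatment_version.
exact: (box_bound_versions hP gP).
Qed.

End LatentNecessity.

(** * Assembling both implications for the five models *)

Theorem theorem1 (R : realType) (M K Q : nat)
    (hM : (2 <= M)%N) (hK : (2 <= K)%N) (hQ : (1 <= Q)%N)
    (mdl : IVmodel)
    (Pm : {ffun 'I_K -> 'I_M} -> R)
    (hPm0 : forall a, 0 <= Pm a) (hPm1 : \sum_a Pm a = 1)
    (Pc : 'I_Q -> 'I_K -> 'I_M -> R)
    (hPc0 : forall q k m, 0 <= Pc q k m)
    (hPc1 : forall q, \sum_(k < K) \sum_(m < M) Pc q k m = 1) :
  compatible mdl Pm Pc <-> ineqs_hold Pm Pc.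
Proof.
have K_gt0 : (0 < K)%N by exact: ltnW.
split; last first.
  move=> ineqs.
  have [kap [kap_ge0 kap_sum1 kap_col]] := kernel_of_ineqs K_gt0 hPm0 hPm1 hPc0 hPc1 ineqs.
  exact: (@realization _ _ _ _ (Ordinal K_gt0) (Ordinal hQ) [ffun=> Ordinal (ltnW hM)] _ _ kap).
move=> [d [Om [P [Z [X [Ypo [Xpo [[mZ mX mYpo mXpo] [model [Z_gt0 [margP condP]]]]]]]]]]].
suff : box_bound P Z X Ypo.
  exact: (ineqs_of_box_bound mZ mX mYpo mXpo Z_gt0 margP condP).
(* The first two models are reduced to the third, since E1 implies E2 and I1 implies I2. *)
case: mdl model => /=.
- move=> [_ [E1 I1]].
  apply: (box_bound_Mod3 mZ mX mYpo mXpo); first exact: (excl_E1_E2 mZ mX mYpo mXpo).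
  exact: (indep_I1_I2 mZ mX mYpo mXpo).
- move=> [E1 I2].
  by apply: (box_bound_Mod3 mZ mX mYpo mXpo); first exact: (excl_E1_E2 mZ mX mYpo mXpo).
- by move=> [E2 I2]; exact: (box_bound_Mod3 mZ mX mYpo mXpo).
- by move=> [consX [E1 I3]]; exact: (box_bound_Mod4 mZ mX mYpo mXpo).
- by move=> [dT [T [U [mU E3 I4]]]]; exact: (box_bound_Mod5 (Ordinal K_gt0) mZ mX mYpo mU).
Qed.
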